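(* Let $\mathbb{X}$ be an additive symmetric monoidal category with finite biproducts. Then $\mathsf{Arr}[\mathbb{X}]$ is an additive symmetric monoidal category with monoidal product $\boxtimes$ and monoidal unit $(0\colon I\to\mathsf{0})$. Moreover, $\mathsf{Arr}[\mathbb{X}]$ also has finite biproducts.
   Context: Symmetric monoidal categories $(\mathbb{X},\otimes,I)$ are written as strict (associators and unitors treated as identities), with symmetry $\sigma_{A,B}\colon A\otimes B\to B\otimes A$. An additive category is a category enriched over commutative monoids: each hom-set is a commutative monoid $(+,0)$ and composition preserves $+$ and $0$ in each argument (no negatives assumed). An additive symmetric monoidal category is a symmetric monoidal category that is additive and such that $\otimes$ of maps preserves $+$ and $0$ in each argument. Biproducts are written $\oplus$ and the zero object $\mathsf{0}$ (biproducts are treated as strict); maps between biproducts are written as matrices, composition being matrix multiplication. Since $\otimes$ preserves the additive structure, $\otimes$ distributes over $\oplus$ via canonical isomorphisms, and $A\otimes\mathsf{0}\cong\mathsf{0}\cong\mathsf{0}\otimes A$. The arrow category $\mathsf{Arr}[\mathbb{X}]$ has as objects the maps $\phi\colon A_0\to A_1$ of $\mathbb{X}$ and as maps $\phi\to\phi'$ the pairs $(f_0\colon A_0\to A_0',\ f_1\colon A_1\to A_1')$ with $f_1\circ\phi=\phi'\circ f_0$; composition and identities are componentwise. Its additive structure is pointwise: $(f_0,f_1)+(g_0,g_1)=(f_0+g_0,f_1+g_1)$, with zero maps $(0,0)$; its biproducts are also pointwise. The product $\boxtimes$ on $\mathsf{Arr}[\mathbb{X}]$: on objects, $(\phi\colon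 A_0\to A_1)\boxtimes(\psi\colon B_0\to B_1)$ is the map $$\begin{bmatrix}1_{A_0}\otimes\psi\\ \phi\otimes 1_{B_0}\end{bmatrix}\colon A_0\otimes B_0\to(A_0\otimes B_1)\oplus(A_1\otimes B_0);$$ on maps, $(f_0,f_1)\boxtimes(g_0,g_1)=\left(f_0\otimes g_0,\ \begin{bmatrix}f_0\otimes g_1&0\\0&f_1\otimes g_0\end{bmatrix}\right)$. The symmetry isomorphism $\phi\boxtimes\psi\to\psi\boxtimes\phi$ is the pair $$\left(\sigma_{A_0,B_0},\ \begin{bmatrix}0&\sigma_{A_1,B_0}\\ \sigma_{A_0,B_1}&0\end{bmatrix}\colon(A_0\otimes B_1)\oplus(A_1\otimes B_0)\to(B_0\otimes A_1)\oplus(B_1\otimes A_0)\right).$$ The associativity and unit coherence isomorphisms are the canonical ones coming from distributivity of $\otimes$ over $\oplus$ (and $A\otimes\mathsf{0}\cong\mathsf{0}$). *)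

(* Defs.v *)
From mathcomp Require Import ssreflect ssrfun ssrbool.
From Stdlib Require Import ProofIrrelevance.

Set Implicit Arguments.
Unset Strict Implicit.
Unset Printing Implicit Defensive.

Declare Scope cat_scope.
Delimit Scope cat_scope with cat.
Local Open Scope cat_scope.

(* Equality of maps is Leibniz equality, and no size condition is imposed on
   objects or hom-types. *)
Record category := Category {
  ob :> Type;
  hom : ob -> ob -> Type;
  idm : forall a, hom a a;
  comp : forall a b c, hom b c -> hom a b -> hom a c;
  comp_idl : forall a b (f : hom a b), comp (idm b) f = f;
  comp_idr : forall a b (f : hom a b), comp f (idm a) = f;
  compA : forall a b c d (h : hom c d) (g : hom b c) (f : hom a b),
    comp h (comp g f) = comp (comp h g) f
}.

Arguments hom {c} a b : rename.
Arguments idm {c} a : rename.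
Arguments comp {c a b c0} g f : rename.

Notation "g ∘ f" := (comp g f) (at level 40, left associativity) : cat_scope.

Definition is_iso (C : category) (a b : C) (f : hom a b) : Prop :=
  exists g : hom b a, g ∘ f = idm a /\ f ∘ g = idm b.

(* Enrichment over commutative monoids; there are no additive inverses. *)
Record additive (C : category) := Additive {
  add : forall a b : C, hom a b -> hom a b -> hom a b;
  zerom : forall a b : C, hom a b;
  addA : forall a b : C, associative (@add a b);
  addC : forall a b : C, commutative (@add a b);
  add0 : forall a b : C, left_id (zerom a b) (@add a b);
  compDl : forall (a b c : C) (g g' : hom b c) (f : hom a b),
    (add g g') ∘ f = add (g ∘ f) (g' ∘ f);
  compDr : forall (a b c : C) (g : hom b c) (f f' : hom a b),
    g ∘ (add f f') = add (g ∘ f) (g ∘ f');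
  comp0l : forall (a b c : C) (f : hom a b), zerom b c ∘ f = zerom a c;
  comp0r : forall (a b c : C) (g : hom b c), g ∘ zerom a b = zerom a c
}.

Arguments add {C} s {a b} f g : rename.
Arguments zerom {C} s {a b} : rename.

Definition is_zero_object (C : category) (z : C) : Prop :=
  forall a : C, (exists! f : hom a z, True) /\ (exists! f : hom z a, True).

Record biproduct (C : category) (S : additive C) (a b s : C) := Biproduct {
  in1 : hom a s;
  in2 : hom b s;
  pr1 : hom s a;
  pr2 : hom s b;
  pr1_in1 : pr1 ∘ in1 = idm a;
  pr2_in2 : pr2 ∘ in2 = idm b;
  pr1_in2 : pr1 ∘ in2 = zerom S;
  pr2_in1 : pr2 ∘ in1 = zerom S;
  in_pr : add S (in1 ∘ pr1) (in2 ∘ pr2) = idm s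
}.

Record finite_biproducts (C : category) (S : additive C)
    (oplus : C -> C -> C) (zob : C) := FiniteBiproducts {
  biprod : forall a b : C, biproduct S a b (oplus a b);
  zobP : is_zero_object zob
}.

(* Monoidal categories are not required to be strict: the associator and the
   unitors are part of the structure. *)
Record symmetric_monoidal (C : category) (tens : C -> C -> C) (unit : C) :=
SymmetricMonoidal {
  tensm : forall a a' b b' : C,
    hom a a' -> hom b b' -> hom (tens a b) (tens a' b');
  assoc : forall a b c : C, hom (tens (tens a b) c) (tens a (tens b c));
  lunit : forall a : C, hom (tens unit a) a;
  runit : forall a : C, hom (tens a unit) a;
  symm : forall a b : C, hom (tens a b) (tens b a);

  tensm_id : forall a b : C, tensm (idm a) (idm b) = idm (tens a b);
  tensm_comp : forall (a a' a'' b b' b'' : C)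
    (f' : hom a' a'') (f : hom a a') (g' : hom b' b'') (g : hom b b'),
    tensm (f' ∘ f) (g' ∘ g) = tensm f' g' ∘ tensm f g;

  assoc_iso : forall a b c : C, is_iso (assoc a b c);
  lunit_iso : forall a : C, is_iso (lunit a);
  runit_iso : forall a : C, is_iso (runit a);

  assoc_nat : forall (a a' b b' c c' : C)
    (f : hom a a') (g : hom b b') (h : hom c c'),
    assoc a' b' c' ∘ tensm (tensm f g) h = tensm f (tensm g h) ∘ assoc a b c;
  lunit_nat : forall (a a' : C) (f : hom a a'),
    lunit a' ∘ tensm (idm unit) f = f ∘ lunit a;
  runit_nat : forall (a a' : C) (f : hom a a'),
    runit a' ∘ tensm f (idm unit) = f ∘ runit a;
  symm_nat : forall (a a' b b' : C) (f : hom a a') (g : hom b b'),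
    symm a' b' ∘ tensm f g = tensm g f ∘ symm a b;

  triangle : forall a b : C,
    tensm (idm a) (lunit b) ∘ assoc a unit b = tensm (runit a) (idm b);
  pentagon : forall a b c d : C,
    assoc a b (tens c d) ∘ assoc (tens a b) c d =
    tensm (idm a) (assoc b c d) ∘ assoc a (tens b c) d
      ∘ tensm (assoc a b c) (idm d);
  symmK : forall a b : C, symm b a ∘ symm a b = idm (tens a b);
  hexagon : forall a b c : C,
    assoc b c a ∘ symm a (tens b c) ∘ assoc a b c =
    tensm (idm b) (symm a c) ∘ assoc b a c ∘ tensm (symm a b) (idm c)
}.

Arguments tensm {C tens unit} M {a a' b b'} f g : rename.
Arguments assoc {C tens unit} M a b c : rename.
Arguments lunit {C tens unit} M a : rename.
Arguments runit {C tens unit} M a : rename.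
Arguments symm {C tens unit} M a b : rename.

Record additive_tensor (C : category) (S : additive C)
    (tens : C -> C -> C) (unit : C) (M : symmetric_monoidal tens unit) : Prop :=
AdditiveTensor {
  tensmDl : forall (a a' b b' : C) (f f' : hom a a') (g : hom b b'),
    tensm M (add S f f') g = add S (tensm M f g) (tensm M f' g);
  tensmDr : forall (a a' b b' : C) (f : hom a a') (g g' : hom b b'),
    tensm M f (add S g g') = add S (tensm M f g) (tensm M f g');
  tensm0l : forall (a a' b b' : C) (g : hom b b'),
    tensm M (zerom S : hom a a') g = zerom S;
  tensm0r : forall (a a' b b' : C) (f : hom a a'),
    tensm M f (zerom S : hom b b') = zerom S
}.

Record arr_ob (C : category) := ArrOb {
  src : C;
  tgt : C;
  arr : hom src tgt
}.

Arguments ArrOb {C src tgt} arr.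

Record arr_hom (C : category) (p q : arr_ob C) := ArrHom {
  hom0 : hom (src p) (src q);
  hom1 : hom (tgt p) (tgt q);
  arr_homP : hom1 ∘ arr p = arr q ∘ hom0
}.

Lemma arr_hom_eq (C : category) (p q : arr_ob C) (f g : arr_hom p q) :
  hom0 f = hom0 g -> hom1 f = hom1 g -> f = g.
Proof.
case: f g => [f0 f1 fP] [g0 g1 gP] /= e0 e1.
by case: _ / e0 gP; case: _ / e1 => gP; rewrite (proof_irrelevance _ fP gP).
Qed.

Definition arr_id (C : category) (p : arr_ob C) : arr_hom p p.
Proof.
by apply: (@ArrHom C p p (idm _) (idm _)); rewrite comp_idl comp_idr.
Defined.

Definition arr_comp (C : category) (p q r : arr_ob C)
  (g : arr_hom q r) (f : arr_hom p q) : arr_hom p r.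
Proof.
apply: (@ArrHom C p r (hom0 g ∘ hom0 f) (hom1 g ∘ hom1 f)).
by rewrite -compA arr_homP compA arr_homP compA.
Defined.

Definition Arr (C : category) : category.
Proof.
apply: (@Category (arr_ob C) (@arr_hom C) (@arr_id C) (@arr_comp C)).
- by move=> p q f; apply: arr_hom_eq; rewrite /= comp_idl.
- by move=> p q f; apply: arr_hom_eq; rewrite /= comp_idr.
- by move=> p q r s h g f; apply: arr_hom_eq; rewrite /= compA.
Defined.

Section Matrices.

Context (C : category) (S : additive C) (oplus : C -> C -> C) (zob : C).
Context (B : finite_biproducts S oplus zob).

Definition inl_ (a b : C) : hom a (oplus a b) := in1 (biprod B a b).
Definition inr_ (a b : C) : hom b (oplus a b) := in2 (biprod B a b).
Definition prl_ (a b : C) : hom (oplus a b) a := pr1 (biprod B a b).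
Definition prr_ (a b : C) : hom (oplus a b) b := pr2 (biprod B a b).

Definition colmx (a b c : C) (f : hom a b) (g : hom a c) : hom a (oplus b c) :=
  add S (inl_ b c ∘ f) (inr_ b c ∘ g).

Definition rowmx (a b c : C) (f : hom a c) (g : hom b c) : hom (oplus a b) c :=
  add S (f ∘ prl_ a b) (g ∘ prr_ a b).

(* The matrix with rows (f11, f12) and (f21, f22): f_ij goes from the j-th
   summand of the source to the i-th summand of the target. *)
Definition mx22 (a b c d : C)
    (f11 : hom a c) (f12 : hom b c) (f21 : hom a d) (f22 : hom b d) :
    hom (oplus a b) (oplus c d) :=
  colmx (rowmx f11 f12) (rowmx f21 f22).

Definition diagmx (a b c d : C) (f : hom a c) (g : hom b d) :
    hom (oplus a b) (oplus c d) :=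
  mx22 f (zerom S) (zerom S) g.

Definition oplusA (a b c : C) :
    hom (oplus a (oplus b c)) (oplus (oplus a b) c) :=
  colmx (colmx (prl_ a (oplus b c)) (prl_ b c ∘ prr_ a (oplus b c)))
        (prr_ b c ∘ prr_ a (oplus b c)).

Context (tens : C -> C -> C) (unit : C) (M : symmetric_monoidal tens unit).

(* Distributivity (a ⊕ b) ⊗ c -> (a ⊗ c) ⊕ (b ⊗ c). *)
Definition distr (a b c : C) :
    hom (tens (oplus a b) c) (oplus (tens a c) (tens b c)) :=
  colmx (tensm M (prl_ a b) (idm c)) (tensm M (prr_ a b) (idm c)).

(* Inverse distributivity (a ⊗ b) ⊕ (a ⊗ c) -> a ⊗ (b ⊕ c). *)
Definition undistl (a b c : C) :
    hom (oplus (tens a b) (tens a c)) (tens a (oplus b c)) :=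
  rowmx (tensm M (idm a) (inl_ b c)) (tensm M (idm a) (inr_ b c)).

Definition box (p q : Arr C) : Arr C :=
  ArrOb (colmx (tensm M (idm (src p)) (arr q)) (tensm M (arr p) (idm (src q)))).

Definition box_unit : Arr C := ArrOb (zerom S : hom unit zob).

Definition box_map1 (p p' q q' : Arr C) (f : hom p p') (g : hom q q') :
    hom (tgt (box p q)) (tgt (box p' q')) :=
  mx22 (tensm M (hom0 f) (hom1 g)) (zerom S)
       (zerom S) (tensm M (hom1 f) (hom0 g)).

Definition box_symm1 (p q : Arr C) : hom (tgt (box p q)) (tgt (box q p)) :=
  mx22 (zerom S) (symm M (tgt p) (src q))
       (symm M (src p) (tgt q)) (zerom S).

(* With p : A0 -> A1, q : B0 -> B1, r : C0 -> C1 this is the composite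
        ((A0 ⊗ B0) ⊗ C1) ⊕ (((A0 ⊗ B1) ⊕ (A1 ⊗ B0)) ⊗ C0)
     -> ((A0 ⊗ B0) ⊗ C1) ⊕ (((A0 ⊗ B1) ⊗ C0) ⊕ ((A1 ⊗ B0) ⊗ C0))
     -> (A0 ⊗ (B0 ⊗ C1)) ⊕ ((A0 ⊗ (B1 ⊗ C0)) ⊕ (A1 ⊗ (B0 ⊗ C0)))
     -> ((A0 ⊗ (B0 ⊗ C1)) ⊕ (A0 ⊗ (B1 ⊗ C0))) ⊕ (A1 ⊗ (B0 ⊗ C0))
     -> (A0 ⊗ ((B0 ⊗ C1) ⊕ (B1 ⊗ C0))) ⊕ (A1 ⊗ (B0 ⊗ C0)). *)
Definition box_assoc1 (p q r : Arr C) :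
    hom (tgt (box (box p q) r)) (tgt (box p (box q r))) :=
  diagmx (undistl _ _ _) (idm _)
  ∘ oplusA _ _ _
  ∘ diagmx (assoc M (src p) (src q) (tgt r))
           (diagmx (assoc M (src p) (tgt q) (src r))
                   (assoc M (tgt p) (src q) (src r)))
  ∘ diagmx (idm _) (distr _ _ _).

(* (I ⊗ A1) ⊕ (0 ⊗ A0) -> A1; the second summand is a zero object, so the
   second entry can only be the zero map.  Symmetrically for box_runit1. *)
Definition box_lunit1 (p : Arr C) : hom (tgt (box box_unit p)) (tgt p) :=
  rowmx (lunit M (tgt p)) (zerom S).

Definition box_runit1 (p : Arr C) : hom (tgt (box p box_unit)) (tgt p) :=
  rowmx (zerom S) (runit M (tgt p)).

Definition arr_oplus (p q : Arr C) : Arr C :=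
  ArrOb (diagmx (arr p) (arr q)).

Definition arr_zob : Arr C := ArrOb (idm zob).

End Matrices.

(* Main.v *)
(* Biproduct injections determine maps out of a direct sum, and since ⊗
   preserves the additive structure the same holds for (a ⊕ b) ⊗ c and
   a ⊗ (b ⊕ c).  The target of an n-fold ⊠-product is thus a sum of n tensor
   products, each with one factor A1 and the others A0.  Every structure map of
   ⊠ sends each of these summands into a single summand by the corresponding
   structure map of X, so each coherence law reduces, summand by summand, to
   the same law in X together with naturality.  In the laws involving the unit,
   the summands with a factor zob are zero objects. *)

Require Import Defs.
From mathcomp Require Import ssreflect ssrfun ssrbool.

Set Implicit Arguments.
Unset Strict Implicit.
Unset Printing Implicit Defensive.

Section ArrBox.

Local Open Scope cat_scope.

(* ssrfun also exports a compA. *)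
Local Notation compA := Defs.compA.

Context (X : category) (S : additive X) (tens : X -> X -> X) (unit : X)
  (M : symmetric_monoidal tens unit) (HM : additive_tensor S M)
  (oplus : X -> X -> X) (zob : X) (B : finite_biproducts S oplus zob).

Local Notation "f ⊗ g" := (tensm M f g) (at level 30, right associativity).
Local Notation "f ⊞ g" := (add S f g) (at level 50, left associativity).
Local Notation "0" := (zerom S).
Local Notation inl := (inl_ B _ _).
Local Notation inr := (inr_ B _ _).
Local Notation prl := (prl_ B _ _).
Local Notation prr := (prr_ B _ _).

(** Composites are kept associated to the right; this form lets an equation for [g ∘ f] rewrite
    inside such a chain, where [f] is followed by a further map [k]. *)
Lemma comp_post (a b c d : X) (g : hom b c) (f : hom a b) (h : hom a c) :
  g ∘ f = h -> forall k : hom d a, g ∘ (f ∘ k) = h ∘ k.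
Proof. by move=> <- k; rewrite compA. Qed.

(** * Matrix calculus for biproducts *)

Lemma addm0 (a b : X) (f : hom a b) : f ⊞ 0 = f.
Proof. by rewrite addC add0. Qed.

Lemma prl_inl (a b : X) : prl_ B a b ∘ inl_ B a b = idm a.
Proof. exact: pr1_in1. Qed.

Lemma prr_inr (a b : X) : prr_ B a b ∘ inr_ B a b = idm b.
Proof. exact: pr2_in2. Qed.

Lemma prl_inr (a b : X) : prl_ B a b ∘ inr_ B a b = 0.
Proof. exact: pr1_in2. Qed.

Lemma prr_inl (a b : X) : prr_ B a b ∘ inl_ B a b = 0.
Proof. exact: pr2_in1. Qed.

Lemma inl_prl_inr_prr (a b : X) :
  (inl_ B a b ∘ prl_ B a b) ⊞ (inr_ B a b ∘ prr_ B a b) = idm (oplus a b).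
Proof. exact: in_pr. Qed.

Lemma rowmx_inl (a b c : X) (f : hom a c) (g : hom b c) :
  rowmx B f g ∘ inl = f.
Proof.
by rewrite /rowmx compDl -!compA prl_inl prr_inl comp_idr comp0r addm0.
Qed.

Lemma rowmx_inr (a b c : X) (f : hom a c) (g : hom b c) :
  rowmx B f g ∘ inr = g.
Proof.
by rewrite /rowmx compDl -!compA prl_inr prr_inr comp_idr comp0r add0.
Qed.

Lemma mx22_inl (a b c d : X)
    (f11 : hom a c) (f12 : hom b c) (f21 : hom a d) (f22 : hom b d) :
  mx22 B f11 f12 f21 f22 ∘ inl = (inl ∘ f11) ⊞ (inr ∘ f21).
Proof. by rewrite /mx22 /colmx compDl -!compA !rowmx_inl. Qed.

Lemma mx22_inr (a b c d : X)
    (f11 : hom a c) (f12 : hom b c) (f21 : hom a d) (f22 : hom b d) :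
  mx22 B f11 f12 f21 f22 ∘ inr = (inl ∘ f12) ⊞ (inr ∘ f22).
Proof. by rewrite /mx22 /colmx compDl -!compA !rowmx_inr. Qed.

Lemma diagmx_inl (a b c d : X) (f : hom a c) (g : hom b d) :
  diagmx B f g ∘ inl = inl ∘ f.
Proof. by rewrite /diagmx mx22_inl comp0r addm0. Qed.

Lemma diagmx_inr (a b c d : X) (f : hom a c) (g : hom b d) :
  diagmx B f g ∘ inr = inr ∘ g.
Proof. by rewrite /diagmx mx22_inr comp0r add0. Qed.

(** The rules for a diagonal matrix against injections and projections are exactly the commuting
    squares needed for the pointwise biproduct of arrows. *)
Lemma prl_diagmx (a b c d : X) (f : hom a c) (g : hom b d) :
  prl ∘ diagmx B f g = f ∘ prl.
Proof.
rewrite /diagmx /mx22 /colmx compDr !compA prl_inl prl_inr comp0l addm0.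
by rewrite comp_idl /rowmx comp0l addm0.
Qed.

Lemma prr_diagmx (a b c d : X) (f : hom a c) (g : hom b d) :
  prr ∘ diagmx B f g = g ∘ prr.
Proof.
rewrite /diagmx /mx22 /colmx compDr !compA prr_inl prr_inr comp0l add0.
by rewrite comp_idl /rowmx comp0l add0.
Qed.

(** * Extensionality for maps out of sums, tensored sums and zero objects *)

Lemma oplus_ext (a b c : X) (f g : hom (oplus a b) c) :
  f ∘ inl = g ∘ inl -> f ∘ inr = g ∘ inr -> f = g.
Proof.
move=> el er; rewrite -[f]comp_idr -[g]comp_idr -inl_prl_inr_prr.
by rewrite !compDr !compA el er.
Qed.

Lemma tensm_compl (a a' a'' b : X) (f : hom a' a'') (g : hom a a') :
  (f ∘ g) ⊗ idm b = (f ⊗ idm b) ∘ (g ⊗ idm b).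
Proof. by rewrite -tensm_comp comp_idl. Qed.

Lemma tensm_compr (a b b' b'' : X) (f : hom b' b'') (g : hom b b') :
  idm a ⊗ (f ∘ g) = (idm a ⊗ f) ∘ (idm a ⊗ g).
Proof. by rewrite -tensm_comp comp_idl. Qed.

Lemma tensl_oplus_ext (a b c d : X) (f g : hom (tens (oplus a b) c) d) :
  f ∘ (inl ⊗ idm c) = g ∘ (inl ⊗ idm c) ->
  f ∘ (inr ⊗ idm c) = g ∘ (inr ⊗ idm c) -> f = g.
Proof.
move=> el er; rewrite -[f]comp_idr -[g]comp_idr -(tensm_id M) -inl_prl_inr_prr.
by rewrite (tensmDl HM) !compDr !tensm_compl !compA el er.
Qed.

Lemma tensr_oplus_ext (a b c d : X) (f g : hom (tens a (oplus b c)) d) :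
  f ∘ (idm a ⊗ inl) = g ∘ (idm a ⊗ inl) ->
  f ∘ (idm a ⊗ inr) = g ∘ (idm a ⊗ inr) -> f = g.
Proof.
move=> el er; rewrite -[f]comp_idr -[g]comp_idr -(tensm_id M) -inl_prl_inr_prr.
by rewrite (tensmDr HM) !compDr !tensm_compr !compA el er.
Qed.

Lemma tensl2_oplus_ext (a b c d e : X)
    (f g : hom (tens (tens (oplus a b) c) d) e) :
  f ∘ ((inl ⊗ idm c) ⊗ idm d) = g ∘ ((inl ⊗ idm c) ⊗ idm d) ->
  f ∘ ((inr ⊗ idm c) ⊗ idm d) = g ∘ ((inr ⊗ idm c) ⊗ idm d) -> f = g.
Proof.
move=> el er; rewrite -[f]comp_idr -[g]comp_idr -2!(tensm_id M).
rewrite -inl_prl_inr_prr !(tensmDl HM) !compDr !tensm_compl !compA.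
by rewrite el er.
Qed.

Lemma to_zob_eq (a : X) (f g : hom a zob) : f = g.
Proof. by case: (proj1 (zobP B a)) => h [_ u]; rewrite -(u f I) (u g I). Qed.

Lemma from_zob_eq (a : X) (f g : hom zob a) : f = g.
Proof. by case: (proj2 (zobP B a)) => h [_ u]; rewrite -(u f I) (u g I). Qed.

(** The identity of [zob] is zero, hence so is that of [tens zob a], and every map out of it
    vanishes. *)
Lemma from_tens_zobl_eq (a b : X) (f g : hom (tens zob a) b) : f = g.
Proof.
rewrite -[f]comp_idr -[g]comp_idr -(tensm_id M) (to_zob_eq (idm zob) 0).
by rewrite (tensm0l HM) !comp0r.
Qed.

Lemma from_tens_zobr_eq (a b : X) (f g : hom (tens a zob) b) : f = g.
Proof.
rewrite -[f]comp_idr -[g]comp_idr -(tensm_id M) (to_zob_eq (idm zob) 0).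
by rewrite (tensm0r HM) !comp0r.
Qed.

(** * Rearrangements of sums, evaluated on injections *)

Lemma distr_inl (a b c : X) : distr B M a b c ∘ (inl ⊗ idm c) = inl.
Proof.
rewrite /distr /colmx compDl -!compA -!tensm_compl prl_inl prr_inl.
by rewrite (tensm0l HM) comp0r addm0 tensm_id comp_idr.
Qed.

Lemma distr_inr (a b c : X) : distr B M a b c ∘ (inr ⊗ idm c) = inr.
Proof.
rewrite /distr /colmx compDl -!compA -!tensm_compl prl_inr prr_inr.
by rewrite (tensm0l HM) comp0r add0 tensm_id comp_idr.
Qed.

Lemma oplusA_inl (a b c : X) : oplusA B a b c ∘ inl = inl ∘ inl.
Proof.
rewrite /oplusA /colmx !compDl -!compA !compDl -!compA prl_inl prr_inl.
by rewrite !comp0r !addm0 comp_idr.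
Qed.

(** The second summand is itself a sum, so the value is left as a row matrix for [rowmx_inl] and
    [rowmx_inr] to evaluate. *)
Lemma oplusA_inr (a b c : X) :
  oplusA B a b c ∘ inr = rowmx B (inl ∘ inr) inr.
Proof.
rewrite /oplusA /colmx /rowmx !compDl -!compA !compDl -!compA prl_inr prr_inr.
by rewrite !comp0r !add0 !comp_idr.
Qed.

(** Antidiagonal matrices, the shape of [box_symm1]. *)
Definition swapmx (a b c d : X) (f : hom b c) (g : hom a d) :
    hom (oplus a b) (oplus c d) :=
  mx22 B 0 f g 0.

Lemma swapmx_inl (a b c d : X) (f : hom b c) (g : hom a d) :
  swapmx f g ∘ inl = inr ∘ g.
Proof. by rewrite /swapmx mx22_inl comp0r add0. Qed.

Lemma swapmx_inr (a b c d : X) (f : hom b c) (g : hom a d) :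
  swapmx f g ∘ inr = inl ∘ f.
Proof. by rewrite /swapmx mx22_inr comp0r addm0. Qed.

(* The domain of f and g has the shape of tgt ((p ⊠ q) ⊠ r),
   and in oplus4_ext that of tgt (((p ⊠ q) ⊠ r) ⊠ s). *)
Lemma oplus3_ext (a b c d e : X)
    (f g : hom (oplus a (tens (oplus b c) d)) e) :
  f ∘ inl = g ∘ inl ->
  f ∘ (inr ∘ (inl ⊗ idm d)) = g ∘ (inr ∘ (inl ⊗ idm d)) ->
  f ∘ (inr ∘ (inr ⊗ idm d)) = g ∘ (inr ∘ (inr ⊗ idm d)) -> f = g.
Proof.
rewrite !compA => e1 e2 e3.
by apply: oplus_ext => //; apply: tensl_oplus_ext.
Qed.

Lemma oplus4_ext (a b c d e k l : X)
    (f g : hom (oplus a (tens (oplus b (tens (oplus c d) e)) k)) l) :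
  f ∘ inl = g ∘ inl ->
  f ∘ (inr ∘ (inl ⊗ idm k)) = g ∘ (inr ∘ (inl ⊗ idm k)) ->
  f ∘ (inr ∘ ((inr ∘ (inl ⊗ idm e)) ⊗ idm k)) =
    g ∘ (inr ∘ ((inr ∘ (inl ⊗ idm e)) ⊗ idm k)) ->
  f ∘ (inr ∘ ((inr ∘ (inr ⊗ idm e)) ⊗ idm k)) =
    g ∘ (inr ∘ ((inr ∘ (inr ⊗ idm e)) ⊗ idm k)) -> f = g.
Proof.
rewrite !tensm_compl => e1 e2 e3 e4; apply: oplus3_ext => //.
by apply: tensl2_oplus_ext; rewrite -!compA.
Qed.

(* box_assoc1 in terms of the objects of X.  It is locked because rewriting
   with associativity would otherwise see through it. *)
Definition assoc3 (a0 a1 b0 b1 c0 c1 : X) :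
    hom (oplus (tens (tens a0 b0) c1)
           (tens (oplus (tens a0 b1) (tens a1 b0)) c0))
        (oplus (tens a0 (oplus (tens b0 c1) (tens b1 c0)))
           (tens a1 (tens b0 c0))) :=
  locked (diagmx B (undistl B M _ _ _) (idm _)
    ∘ oplusA B _ _ _
    ∘ diagmx B (assoc M a0 b0 c1)
        (diagmx B (assoc M a0 b1 c0) (assoc M a1 b0 c0))
    ∘ diagmx B (idm _) (distr B M _ _ _)).

(** * The associator of ⊠ on its three summands, and its inverse *)

Section Assoc3.

Context (a0 a1 b0 b1 c0 c1 : X).
Local Notation assoc3' := (assoc3 a0 a1 b0 b1 c0 c1).

Lemma assoc3_inl : assoc3' ∘ inl = inl ∘ ((idm _ ⊗ inl) ∘ assoc M _ _ _).
Proof.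
rewrite /assoc3 -lock -!compA diagmx_inl comp_idr diagmx_inl.
rewrite (comp_post (oplusA_inl _ _ _)) -!compA (comp_post (diagmx_inl _ _)).
by rewrite -compA (comp_post (rowmx_inl _ _)).
Qed.

Lemma assoc3_inr_inl :
  assoc3' ∘ (inr ∘ (inl ⊗ idm _)) = inl ∘ ((idm _ ⊗ inr) ∘ assoc M _ _ _).
Proof.
rewrite /assoc3 -lock -!compA (comp_post (diagmx_inr _ _)) -compA distr_inl.
rewrite (comp_post (diagmx_inr _ _)) -compA diagmx_inl.
rewrite (comp_post (oplusA_inr _ _ _)) (comp_post (rowmx_inl _ _)) -compA.
by rewrite (comp_post (diagmx_inl _ _)) -compA (comp_post (rowmx_inr _ _)).
Qed.

Lemma assoc3_inr_inr : assoc3' ∘ (inr ∘ (inr ⊗ idm _)) = inr ∘ assoc M _ _ _.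
Proof.
rewrite /assoc3 -lock -!compA (comp_post (diagmx_inr _ _)) -compA distr_inr.
rewrite (comp_post (diagmx_inr _ _)) -compA diagmx_inr.
rewrite (comp_post (oplusA_inr _ _ _)) (comp_post (rowmx_inr _ _)).
by rewrite (comp_post (diagmx_inr _ _)) comp_idr.
Qed.

(** The inverse is assembled from the inverses of the three associators of X, and both composites
    are checked on injections. *)
Lemma assoc3_iso : is_iso assoc3'.
Proof.
have [g1 [ga1 ag1]] := assoc_iso M a0 b0 c1.
have [g2 [ga2 ag2]] := assoc_iso M a0 b1 c0.
have [g3 [ga3 ag3]] := assoc_iso M a1 b0 c0.
(* [h2] is the inverse on the target summand with factor [a0]: it projects inside the second tensor
   factor, undoes the associator and reinjects. *)
pose h2 : hom (tens a0 (oplus (tens b0 c1) (tens b1 c0)))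
    (oplus (tens (tens a0 b0) c1)
       (tens (oplus (tens a0 b1) (tens a1 b0)) c0)) :=
  (inl ∘ (g1 ∘ (idm _ ⊗ prl))) ⊞
  (inr ∘ ((inl ⊗ idm _) ∘ (g2 ∘ (idm _ ⊗ prr)))).
have h2l : h2 ∘ (idm _ ⊗ inl) = inl ∘ g1.
  rewrite /h2 compDl -!compA -!tensm_compr prl_inl prr_inl (tensm0r HM).
  by rewrite !comp0r addm0 tensm_id comp_idr.
have h2r : h2 ∘ (idm _ ⊗ inr) = inr ∘ ((inl ⊗ idm _) ∘ g2).
  rewrite /h2 compDl -!compA -!tensm_compr prl_inr prr_inr (tensm0r HM).
  by rewrite !comp0r add0 tensm_id comp_idr.
pose h := rowmx B h2 (inr ∘ ((inr ⊗ idm _) ∘ g3)).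
have hl : h ∘ inl = h2 by exact: rowmx_inl.
have hr : h ∘ inr = inr ∘ ((inr ⊗ idm _) ∘ g3) by exact: rowmx_inr.
exists h; split.
- apply: oplus3_ext; rewrite comp_idl -compA.
  + by rewrite assoc3_inl (comp_post hl) (comp_post h2l) -compA ga1 comp_idr.
  + rewrite assoc3_inr_inl (comp_post hl) (comp_post h2r) -!compA ga2.
    by rewrite comp_idr.
  + by rewrite assoc3_inr_inr (comp_post hr) -!compA ga3 comp_idr.
- apply: oplus_ext; rewrite comp_idl -compA.
  + rewrite hl; apply: tensr_oplus_ext; rewrite -compA.
    * by rewrite h2l (comp_post assoc3_inl) -!compA ag1 comp_idr.
    (* Regrouping joins [inr] to the tensored injection, giving the composite on which [assoc3] is
       known. *)
    * rewrite h2r [inr ∘ _]compA (comp_post assoc3_inr_inl).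
      by rewrite -!compA ag2 comp_idr.
  + rewrite hr [inr ∘ _]compA (comp_post assoc3_inr_inr).
    by rewrite -!compA ag3 comp_idr.
Qed.

End Assoc3.

(** * Structure maps of ⊠ and their commuting squares *)

Lemma box_map1E (p p' q q' : Arr X) (f : hom p p') (g : hom q q') :
  box_map1 B M f g = diagmx B (hom0 f ⊗ hom1 g) (hom1 f ⊗ hom0 g).
Proof. by []. Qed.

Lemma box_symm1E (p q : Arr X) :
  box_symm1 B M p q =
  swapmx (symm M (tgt p) (src q)) (symm M (src p) (tgt q)).
Proof. by []. Qed.

Lemma box_assoc1E (p q r : Arr X) :
  box_assoc1 B M p q r =
  assoc3 (src p) (tgt p) (src q) (tgt q) (src r) (tgt r).
Proof. by rewrite /assoc3 -lock. Qed.

(** Brings second components into the forms whose values on injections have been computed. *)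
Definition box1E := (box_map1E, box_symm1E, box_assoc1E).

(** By interchange, each of the two entries reduces to the square of [f] or of [g]. *)
Lemma box_map_subproof (p p' q q' : Arr X) (f : hom p p') (g : hom q q') :
  box_map1 B M f g ∘ arr (box B M p q) =
  arr (box B M p' q') ∘ (hom0 f ⊗ hom0 g).
Proof.
rewrite box1E /= /colmx compDr compDl (comp_post (diagmx_inl _ _)).
rewrite (comp_post (diagmx_inr _ _)) -!compA -!tensm_comp.
by rewrite !arr_homP !comp_idl !comp_idr.
Qed.

Definition box_map (p p' q q' : Arr X) (f : hom p p') (g : hom q q') :
    hom (box B M p q) (box B M p' q') :=
  ArrHom (box_map_subproof f g).

(** Naturality of the symmetry matches the two entries in opposite order, whence the use of
    [addC]. *)
Lemma box_symm_subproof (p q : Arr X) :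
  box_symm1 B M p q ∘ arr (box B M p q) =
  arr (box B M q p) ∘ symm M (src p) (src q).
Proof.
rewrite box1E /= /colmx compDr compDl (comp_post (swapmx_inl _ _)).
by rewrite (comp_post (swapmx_inr _ _)) -!compA !symm_nat addC.
Qed.

Definition box_symm (p q : Arr X) : hom (box B M p q) (box B M q p) :=
  ArrHom (box_symm_subproof p q).

(** One term per summand, each starting with an injection on which [assoc3] is known. *)
Lemma arr_box_boxl (p q r : Arr X) :
  arr (box B M (box B M p q) r) =
  (inl ∘ (idm _ ⊗ arr r)) ⊞
  ((inr ∘ (inl ⊗ idm _) ∘ ((idm _ ⊗ arr q) ⊗ idm _)) ⊞
   (inr ∘ (inr ⊗ idm _) ∘ ((arr p ⊗ idm _) ⊗ idm _))).
Proof.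
by rewrite /= /colmx (tensmDl HM) compDr !tensm_compl !compA.
Qed.

(** The last term keeps [idm _ ⊗ idm _] split, as naturality of the associator produces it. *)
Lemma arr_box_boxr (p q r : Arr X) :
  arr (box B M p (box B M q r)) =
  (inl ∘ ((idm _ ⊗ inl) ∘ (idm _ ⊗ (idm _ ⊗ arr r)))) ⊞
  ((inl ∘ ((idm _ ⊗ inr) ∘ (idm _ ⊗ (arr q ⊗ idm _)))) ⊞
   (inr ∘ (arr p ⊗ (idm _ ⊗ idm _)))).
Proof.
by rewrite /= /colmx (tensmDr HM) compDr !tensm_compr tensm_id addA.
Qed.

Lemma box_assoc_subproof (p q r : Arr X) :
  box_assoc1 B M p q r ∘ arr (box B M (box B M p q) r) =
  arr (box B M p (box B M q r)) ∘ assoc M (src p) (src q) (src r).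
Proof.
rewrite box1E arr_box_boxl arr_box_boxr !compDr !compDl /=.
rewrite (comp_post (assoc3_inl _ _ _ _ _ _)).
rewrite (comp_post (assoc3_inr_inl _ _ _ _ _ _)).
rewrite (comp_post (assoc3_inr_inr _ _ _ _ _ _)).
(* In the term of [arr r] the identity must be split into two factors before naturality of the
   associator applies. *)
by rewrite -(tensm_id M (src p) (src q)) -!compA !assoc_nat.
Qed.

Definition box_assoc (p q r : Arr X) :
    hom (box B M (box B M p q) r) (box B M p (box B M q r)) :=
  ArrHom (box_assoc_subproof p q r).

(** The arrow of the unit is zero, so the second entry of the product vanishes and naturality of the
    unitor settles the first. *)
Lemma box_lunit_subproof (p : Arr X) :
  box_lunit1 B M p ∘ arr (box B M (box_unit S zob unit) p) =
  arr p ∘ lunit M (src p).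
Proof.
rewrite /= /colmx (tensm0l HM) comp0r addm0.
by rewrite (comp_post (rowmx_inl _ _)) lunit_nat.
Qed.

Definition box_lunit (p : Arr X) : hom (box B M (box_unit S zob unit) p) p :=
  ArrHom (box_lunit_subproof p).

Lemma box_runit_subproof (p : Arr X) :
  box_runit1 B M p ∘ arr (box B M p (box_unit S zob unit)) =
  arr p ∘ runit M (src p).
Proof.
rewrite /= /colmx (tensm0r HM) comp0r add0.
by rewrite (comp_post (rowmx_inr _ _)) runit_nat.
Qed.

Definition box_runit (p : Arr X) : hom (box B M p (box_unit S zob unit)) p :=
  ArrHom (box_runit_subproof p).

(** * Invertibility of the associator and the unitors *)

Lemma arr_is_iso (p q : Arr X) (f : hom p q) :
  is_iso (hom0 f) -> is_iso (hom1 f) -> is_iso f.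
Proof.
move=> [g0 [gf0 fg0]] [g1 [gf1 fg1]].
have gP : g1 ∘ arr q = arr p ∘ g0.
  (* The square of the inverses is the square of [f] with [g1] composed on one side and [g0] on the
     other. *)
  rewrite -[arr q]comp_idr -fg0 [arr q ∘ _]compA -arr_homP -[in LHS]compA compA.
  by rewrite gf1 comp_idl.
by exists (ArrHom gP); split; apply: arr_hom_eq.
Qed.

Lemma box_assoc_iso (p q r : Arr X) : is_iso (box_assoc p q r).
Proof.
apply: arr_is_iso; first exact: assoc_iso.
by rewrite /= box1E; apply: assoc3_iso.
Qed.

Lemma box_lunit_iso (p : Arr X) : is_iso (box_lunit p).
Proof.
apply: arr_is_iso; first exact: lunit_iso.
have [g [gl lg]] := lunit_iso M (tgt p).
(* The other summand has a factor [zob], so injecting after the inverse unitor gives a two-sided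
   inverse. *)
exists (inl ∘ g); split; last by rewrite /= (comp_post (rowmx_inl _ _)).
apply: oplus_ext; last exact: from_tens_zobl_eq.
by rewrite -!compA rowmx_inl gl comp_idr comp_idl.
Qed.

Lemma box_runit_iso (p : Arr X) : is_iso (box_runit p).
Proof.
apply: arr_is_iso; first exact: runit_iso.
have [g [gr rg]] := runit_iso M (tgt p).
exists (inr ∘ g); split; last by rewrite /= (comp_post (rowmx_inr _ _)).
apply: oplus_ext; first exact: from_tens_zobr_eq.
by rewrite -!compA rowmx_inr gr comp_idr comp_idl.
Qed.

(** * Functoriality and naturality *)

Lemma box_map_id (p q : Arr X) :
  box_map (idm p) (idm q) = idm (box B M p q).
Proof.
apply: arr_hom_eq; first exact: tensm_id.
by apply: oplus_ext;
  rewrite /= box1E ?diagmx_inl ?diagmx_inr /= tensm_id comp_idl comp_idr.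
Qed.

Lemma box_map_comp (p p' p'' q q' q'' : Arr X) (f' : hom p' p'')
    (f : hom p p') (g' : hom q' q'') (g : hom q q') :
  box_map (f' ∘ f) (g' ∘ g) = box_map f' g' ∘ box_map f g.
Proof.
apply: arr_hom_eq; first exact: tensm_comp.
apply: oplus_ext; rewrite /= !box1E -compA /=.
- by rewrite !diagmx_inl (comp_post (diagmx_inl _ _)) -compA -tensm_comp.
- by rewrite !diagmx_inr (comp_post (diagmx_inr _ _)) -compA -tensm_comp.
Qed.

Lemma box_assoc_nat (p p' q q' r r' : Arr X) (f : hom p p') (g : hom q q')
    (h : hom r r') :
  box_assoc p' q' r' ∘ box_map (box_map f g) h =
  box_map f (box_map g h) ∘ box_assoc p q r.
Proof.
apply: arr_hom_eq; first exact: assoc_nat.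
apply: oplus3_ext; rewrite /= !box1E /= !box1E -!compA.
- rewrite diagmx_inl (comp_post (assoc3_inl _ _ _ _ _ _)) -!compA assoc_nat.
  rewrite assoc3_inl (comp_post (diagmx_inl _ _)) -!compA.
  (* Merging the tensors makes the diagonal matrix meet the injection inside the second factor. *)
  rewrite (compA (_ ⊗ diagmx _ _ _)) (compA (idm _ ⊗ _)) -!tensm_comp.
  by rewrite diagmx_inl comp_idl comp_idr.
- rewrite (comp_post (diagmx_inr _ _)) -!compA -tensm_comp diagmx_inl.
  (* Writing [hom0 h] as [idm _ ∘ hom0 h] splits off the injection [inl ⊗ idm _]. *)
  rewrite comp_idr -[hom0 h]comp_idl tensm_comp [inr ∘ _]compA.
  rewrite (comp_post (assoc3_inr_inl _ _ _ _ _ _)) -!compA assoc_nat.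
  rewrite assoc3_inr_inl (comp_post (diagmx_inl _ _)) -!compA comp_idl.
  rewrite (compA (_ ⊗ diagmx _ _ _)) (compA (idm _ ⊗ _)) -!tensm_comp.
  by rewrite diagmx_inr comp_idl comp_idr.
- rewrite (comp_post (diagmx_inr _ _)) -!compA -tensm_comp diagmx_inr.
  rewrite comp_idr -[hom0 h]comp_idl tensm_comp [inr ∘ _]compA.
  rewrite (comp_post (assoc3_inr_inr _ _ _ _ _ _)) -!compA assoc_nat comp_idl.
  by rewrite assoc3_inr_inr (comp_post (diagmx_inr _ _)) -!compA.
Qed.

Lemma box_lunit_nat (p p' : Arr X) (f : hom p p') :
  box_lunit p' ∘ box_map (idm _) f = f ∘ box_lunit p.
Proof.
apply: arr_hom_eq; first exact: lunit_nat.
apply: oplus_ext; last exact: from_tens_zobl_eq.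
rewrite /= box1E -!compA diagmx_inl rowmx_inl.
by rewrite (comp_post (rowmx_inl _ _)) lunit_nat.
Qed.

Lemma box_runit_nat (p p' : Arr X) (f : hom p p') :
  box_runit p' ∘ box_map f (idm _) = f ∘ box_runit p.
Proof.
apply: arr_hom_eq; first exact: runit_nat.
apply: oplus_ext; first exact: from_tens_zobr_eq.
rewrite /= box1E -!compA diagmx_inr rowmx_inr.
by rewrite (comp_post (rowmx_inr _ _)) runit_nat.
Qed.

Lemma box_symm_nat (p p' q q' : Arr X) (f : hom p p') (g : hom q q') :
  box_symm p' q' ∘ box_map f g = box_map g f ∘ box_symm p q.
Proof.
apply: arr_hom_eq; first exact: symm_nat.
apply: oplus_ext; rewrite /= !box1E -!compA.
- rewrite diagmx_inl (comp_post (swapmx_inl _ _)) swapmx_inl.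
  by rewrite (comp_post (diagmx_inr _ _)) -!compA symm_nat.
- rewrite diagmx_inr (comp_post (swapmx_inr _ _)) swapmx_inr.
  by rewrite (comp_post (diagmx_inl _ _)) -!compA symm_nat.
Qed.

(** * Involutivity of the symmetry, triangle, hexagon and pentagon *)

Lemma box_symmK (p q : Arr X) :
  box_symm q p ∘ box_symm p q = idm (box B M p q).
Proof.
apply: arr_hom_eq; first exact: symmK.
apply: oplus_ext; rewrite /= !box1E -!compA comp_idl.
- by rewrite swapmx_inl (comp_post (swapmx_inr _ _)) -compA symmK comp_idr.
- by rewrite swapmx_inr (comp_post (swapmx_inl _ _)) -compA symmK comp_idr.
Qed.

Lemma box_triangle (p q : Arr X) :
  box_map (idm p) (box_lunit q) ∘ box_assoc p (box_unit S zob unit) q =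
  box_map (box_runit p) (idm q).
Proof.
apply: arr_hom_eq; first exact: triangle.
apply: oplus3_ext; rewrite /= !box1E -?compA /=.
- rewrite assoc3_inl (comp_post (diagmx_inl _ _)) diagmx_inl -!compA.
  rewrite (compA (_ ⊗ box_lunit1 B M q)) -tensm_compr.
  by rewrite rowmx_inl triangle.
(* This summand has [zob] as its middle factor, and both unitor matrices have entry zero there, so
   both sides vanish. The other two summands use the triangle of X. *)
- rewrite assoc3_inr_inl (comp_post (diagmx_inl _ _)) -!compA.
  rewrite (compA (_ ⊗ box_lunit1 B M q)) -tensm_compr rowmx_inr.
  rewrite (comp_post (diagmx_inr _ _)) -compA -tensm_compl rowmx_inl.
  by rewrite (tensm0r HM) (tensm0l HM) comp0l !comp0r.
- rewrite assoc3_inr_inr (comp_post (diagmx_inr _ _)) -!compA triangle.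
  by rewrite (comp_post (diagmx_inr _ _)) -compA -tensm_compl rowmx_inr.
Qed.

Lemma box_hexagon (p q r : Arr X) :
  box_assoc q r p ∘ box_symm p (box B M q r) ∘ box_assoc p q r =
  box_map (idm q) (box_symm p r) ∘ box_assoc q p r
    ∘ box_map (box_symm p q) (idm r).
Proof.
apply: arr_hom_eq; first exact: hexagon.
apply: oplus3_ext; rewrite /= !box1E /= !box1E -!compA.
- rewrite assoc3_inl (comp_post (swapmx_inl _ _)) -compA.
  (* Naturality of the symmetry moves the injection from the right tensor factor to the left one,
     ready for the next [assoc3]. *)
  rewrite (compA (symm M _ _)) symm_nat -!compA (compA inr (_ ⊗ idm _)).
  rewrite (comp_post (assoc3_inr_inl _ _ _ _ _ _)) -!compA.
  rewrite diagmx_inl (comp_post (assoc3_inl _ _ _ _ _ _)) -!compA.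
  rewrite (comp_post (diagmx_inl _ _)) -!compA.
  rewrite (compA (_ ⊗ swapmx _ _)) -tensm_compr swapmx_inl.
  rewrite tensm_compr -!compA (compA (assoc M _ _ _) (symm M _ _)).
  by rewrite hexagon -!compA.
- rewrite assoc3_inr_inl (comp_post (swapmx_inl _ _)) -compA.
  rewrite (compA (symm M _ _)) symm_nat -!compA (compA inr (_ ⊗ idm _)).
  rewrite (comp_post (assoc3_inr_inr _ _ _ _ _ _)) -!compA.
  rewrite (comp_post (diagmx_inr _ _)) -compA -tensm_compl swapmx_inl.
  rewrite tensm_compl (compA inr (_ ⊗ idm _)).
  rewrite (comp_post (assoc3_inr_inr _ _ _ _ _ _)) -!compA.
  rewrite (comp_post (diagmx_inr _ _)) -!compA.
  by rewrite (compA (assoc M _ _ _) (symm M _ _)) hexagon -!compA.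
- rewrite assoc3_inr_inr (comp_post (swapmx_inr _ _)) -compA.
  rewrite (comp_post (assoc3_inl _ _ _ _ _ _)) -!compA.
  rewrite (comp_post (diagmx_inr _ _)) -compA -tensm_compl swapmx_inr.
  rewrite tensm_compl (compA inr (_ ⊗ idm _)).
  rewrite (comp_post (assoc3_inr_inl _ _ _ _ _ _)) -!compA.
  rewrite (comp_post (diagmx_inl _ _)) -!compA.
  rewrite (compA (_ ⊗ swapmx _ _)) -tensm_compr swapmx_inr.
  rewrite tensm_compr -!compA (compA (assoc M _ _ _) (symm M _ _)).
  by rewrite hexagon -!compA.
Qed.

(** The four cases place the target object in the factor of [s], [r], [q] and [p] in turn; each is a
    pentagon of X once the injections have been moved to the left. *)
Lemma box_pentagon (p q r s : Arr X) :
  box_assoc p q (box B M r s) ∘ box_assoc (box B M p q) r s =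
  box_map (idm p) (box_assoc q r s) ∘ box_assoc p (box B M q r) s
    ∘ box_map (box_assoc p q r) (idm s).
Proof.
apply: arr_hom_eq; first exact: pentagon.
apply: oplus4_ext; rewrite /= !box1E /= !box1E -!compA.
- rewrite assoc3_inl (comp_post (assoc3_inl _ _ _ _ _ _)) -!compA.
  rewrite -(tensm_id M (src p) (src q)) (compA (assoc M _ _ _)) assoc_nat.
  rewrite diagmx_inl (comp_post (assoc3_inl _ _ _ _ _ _)) -!compA pentagon.
  rewrite (comp_post (diagmx_inl _ _)) -!compA (compA (_ ⊗ assoc3 _ _ _ _ _ _)).
  by rewrite -tensm_compr assoc3_inl !tensm_compr -!compA.
- rewrite assoc3_inr_inl (comp_post (assoc3_inl _ _ _ _ _ _)) -!compA.
  rewrite -(tensm_id M (src p) (src q)) (compA (assoc M _ _ _)) assoc_nat.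
  rewrite (comp_post (diagmx_inr _ _)) -!compA -tensm_compl assoc3_inl.
  rewrite !tensm_compl (compA inr (_ ⊗ idm _)).
  rewrite (comp_post (assoc3_inr_inl _ _ _ _ _ _)) -!compA pentagon.
  (* The injection inside the middle factor passes the associator, so that [assoc3] for [q], [r],
     [s] can act on it within the second tensor factor. *)
  rewrite (compA (assoc M _ _ _) ((_ ⊗ _) ⊗ _)) assoc_nat -!compA.
  rewrite (comp_post (diagmx_inl _ _)) -!compA.
  rewrite (compA (_ ⊗ inr)) -tensm_compr (compA (_ ⊗ assoc3 _ _ _ _ _ _)).
  by rewrite -tensm_compr assoc3_inr_inl !tensm_compr -!compA.
- rewrite tensm_compl (compA inr (_ ⊗ idm _)).
  (* Merging the identities of [src r] and [src s] restores the shape [inl ⊗ idm _] expected by the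
     next [assoc3]. *)
  rewrite (comp_post (assoc3_inr_inr _ _ _ _ _ _)) -!compA assoc_nat tensm_id.
  rewrite (compA inr (_ ⊗ idm _)) (comp_post (assoc3_inr_inl _ _ _ _ _ _)).
  rewrite -!compA pentagon -tensm_compl (comp_post (diagmx_inr _ _)) -!compA.
  rewrite -tensm_compl assoc3_inr_inl !tensm_compl (compA inr (_ ⊗ idm _)).
  rewrite (comp_post (assoc3_inr_inl _ _ _ _ _ _)) -!compA.
  rewrite (compA (assoc M _ _ _) ((_ ⊗ _) ⊗ _)) assoc_nat -!compA.
  rewrite (comp_post (diagmx_inl _ _)) -!compA.
  rewrite (compA (_ ⊗ inr) (_ ⊗ (_ ⊗ _))) -tensm_compr.
  rewrite (compA (_ ⊗ assoc3 _ _ _ _ _ _)) -tensm_compr assoc3_inr_inr.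
  by rewrite !tensm_compr -!compA.
- rewrite tensm_compl (compA inr (_ ⊗ idm _)).
  rewrite (comp_post (assoc3_inr_inr _ _ _ _ _ _)) -!compA assoc_nat tensm_id.
  rewrite (compA inr (_ ⊗ idm _)) (comp_post (assoc3_inr_inr _ _ _ _ _ _)).
  rewrite -!compA pentagon -tensm_compl (comp_post (diagmx_inr _ _)) -!compA.
  rewrite -tensm_compl assoc3_inr_inr !tensm_compl (compA inr (_ ⊗ idm _)).
  rewrite (comp_post (assoc3_inr_inr _ _ _ _ _ _)) -!compA.
  by rewrite (comp_post (diagmx_inr _ _)) -!compA.
Qed.

Definition box_symmetric_monoidal :
    symmetric_monoidal (box B M) (box_unit S zob unit) :=
  SymmetricMonoidal box_map_id box_map_comp box_assoc_iso box_lunit_iso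
    box_runit_iso box_assoc_nat box_lunit_nat box_runit_nat box_symm_nat
    box_triangle box_pentagon box_symmK box_hexagon.

(** * The pointwise additive structure and its preservation by ⊠ *)

Lemma arr_add_subproof (p q : Arr X) (f g : hom p q) :
  (hom1 f ⊞ hom1 g) ∘ arr p = arr q ∘ (hom0 f ⊞ hom0 g).
Proof. by rewrite compDl compDr !arr_homP. Qed.

Definition arr_add (p q : Arr X) (f g : hom p q) : hom p q :=
  ArrHom (arr_add_subproof f g).

Lemma arr_zerom_subproof (p q : Arr X) : 0 ∘ arr p = arr q ∘ 0.
Proof. by rewrite comp0l comp0r. Qed.

Definition arr_zerom (p q : Arr X) : hom p q :=
  ArrHom (arr_zerom_subproof p q).

(** Transparent, so that sums and zero maps compute componentwise. *)
Definition arr_additive : additive (Arr X).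
Proof.
apply: (@Additive (Arr X) arr_add arr_zerom).
- by move=> p q f g h; apply: arr_hom_eq; apply: addA.
- by move=> p q f g; apply: arr_hom_eq; apply: addC.
- by move=> p q f; apply: arr_hom_eq; apply: add0.
- by move=> p q r g g' f; apply: arr_hom_eq; apply: compDl.
- by move=> p q r g f f'; apply: arr_hom_eq; apply: compDr.
- by move=> p q r f; apply: arr_hom_eq; apply: comp0l.
- by move=> p q r g; apply: arr_hom_eq; apply: comp0r.
Defined.

Lemma diagmxD (a b c d : X) (f f' : hom a c) (g g' : hom b d) :
  diagmx B (f ⊞ f') (g ⊞ g') = diagmx B f g ⊞ diagmx B f' g'.
Proof.
by apply: oplus_ext;
  rewrite compDl ?diagmx_inl ?diagmx_inr compDr.
Qed.

Lemma diagmx0 (a b c d : X) :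
  diagmx B (0 : hom a c) (0 : hom b d) = 0.
Proof.
by apply: oplus_ext; rewrite ?diagmx_inl ?diagmx_inr comp0l comp0r.
Qed.

(** First components are the laws of X; second components are diagonal matrices of tensors, which
    are additive entry by entry. *)
Lemma box_additive_tensor : additive_tensor arr_additive box_symmetric_monoidal.
Proof.
split=> [p p' q q' f f' g|p p' q q' f g g'|p p' q q' g|p p' q q' f];
  apply: arr_hom_eq; rewrite /= ?box1E /=.
- exact: tensmDl.
- by rewrite !(tensmDl HM) diagmxD.
- exact: tensmDr.
- by rewrite !(tensmDr HM) diagmxD.
- exact: tensm0l.
- by rewrite !(tensm0l HM) diagmx0.
- exact: tensm0r.
- by rewrite !(tensm0r HM) diagmx0.
Qed.

(** * Pointwise biproducts and zero object *)

Definition arr_inl (p q : Arr X) : hom p (arr_oplus B p q) :=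
  @ArrHom X p (arr_oplus B p q) inl inl (esym (diagmx_inl (arr p) (arr q))).

Definition arr_inr (p q : Arr X) : hom q (arr_oplus B p q) :=
  @ArrHom X q (arr_oplus B p q) inr inr (esym (diagmx_inr (arr p) (arr q))).

Definition arr_prl (p q : Arr X) : hom (arr_oplus B p q) p :=
  @ArrHom X (arr_oplus B p q) p prl prl (prl_diagmx (arr p) (arr q)).

Definition arr_prr (p q : Arr X) : hom (arr_oplus B p q) q :=
  @ArrHom X (arr_oplus B p q) q prr prr (prr_diagmx (arr p) (arr q)).

Definition arr_biproduct (p q : Arr X) :
  biproduct arr_additive p q (arr_oplus B p q).
Proof.
apply: (@Biproduct (Arr X) arr_additive p q (arr_oplus B p q)
  (arr_inl p q) (arr_inr p q) (arr_prl p q) (arr_prr p q)).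
- by apply: arr_hom_eq; apply: prl_inl.
- by apply: arr_hom_eq; apply: prr_inr.
- by apply: arr_hom_eq; apply: prl_inr.
- by apply: arr_hom_eq; apply: prr_inl.
- by apply: arr_hom_eq; apply: inl_prl_inr_prr.
Defined.

Lemma arr_zobP : is_zero_object (arr_zob zob).
Proof.
move=> p; split.
- exists (@ArrHom X p (arr_zob zob) 0 0 (to_zob_eq _ _)).
  by split=> // f _; apply: arr_hom_eq; apply: to_zob_eq.
- exists (@ArrHom X (arr_zob zob) p 0 0 (from_zob_eq _ _)).
  by split=> // f _; apply: arr_hom_eq; apply: from_zob_eq.
Qed.

Definition arr_finite_biproducts :
    finite_biproducts arr_additive (arr_oplus B) (arr_zob zob) :=
  FiniteBiproducts arr_biproduct arr_zobP.

End ArrBox.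

Theorem lemma6p2 (X : category) (S : additive X)
    (tens : X -> X -> X) (unit : X) (M : symmetric_monoidal tens unit)
    (HM : additive_tensor S M)
    (oplus : X -> X -> X) (zob : X) (B : finite_biproducts S oplus zob) :
  exists (S' : additive (Arr X))
         (M' : symmetric_monoidal (box B M) (box_unit S zob unit))
         (B' : finite_biproducts S' (arr_oplus B) (arr_zob zob)),
  additive_tensor S' M' /\
  (* the additive structure is pointwise *)
  (forall (p q : Arr X) (f g : hom p q),
     hom0 (add S' f g) = add S (hom0 f) (hom0 g) /\
     hom1 (add S' f g) = add S (hom1 f) (hom1 g)) /\
  (forall p q : Arr X,
     hom0 (zerom S' : hom p q) = zerom S /\
     hom1 (zerom S' : hom p q) = zerom S) /\
  (* the monoidal product of maps and the coherence isomorphisms *)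
  (forall (p p' q q' : Arr X) (f : hom p p') (g : hom q q'),
     hom0 (tensm M' f g) = tensm M (hom0 f) (hom0 g) /\
     hom1 (tensm M' f g) = box_map1 B M f g) /\
  (forall p q : Arr X,
     hom0 (symm M' p q) = symm M (src p) (src q) /\
     hom1 (symm M' p q) = box_symm1 B M p q) /\
  (forall p q r : Arr X,
     hom0 (assoc M' p q r) = assoc M (src p) (src q) (src r) /\
     hom1 (assoc M' p q r) = box_assoc1 B M p q r) /\
  (forall p : Arr X,
     hom0 (lunit M' p) = lunit M (src p) /\
     hom1 (lunit M' p) = box_lunit1 B M p) /\
  (forall p : Arr X,
     hom0 (runit M' p) = runit M (src p) /\
     hom1 (runit M' p) = box_runit1 B M p) /\
  (* the biproducts are pointwise *)
  (forall p q : Arr X,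
     (hom0 (inl_ B' p q) = inl_ B (src p) (src q) /\
      hom1 (inl_ B' p q) = inl_ B (tgt p) (tgt q)) /\
     (hom0 (inr_ B' p q) = inr_ B (src p) (src q) /\
      hom1 (inr_ B' p q) = inr_ B (tgt p) (tgt q)) /\
     (hom0 (prl_ B' p q) = prl_ B (src p) (src q) /\
      hom1 (prl_ B' p q) = prl_ B (tgt p) (tgt q)) /\
     (hom0 (prr_ B' p q) = prr_ B (src p) (src q) /\
      hom1 (prr_ B' p q) = prr_ B (tgt p) (tgt q))).
Proof.
exists (arr_additive S), (box_symmetric_monoidal HM B),
  (arr_finite_biproducts B).
split; first exact: box_additive_tensor.
(* All remaining equations between components hold by computation. *)
by do !split.
Qed.
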